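(* For every prime $p$, every positive integer $x$ and every positive integer $n$, \[ \nu_p\bigl(sf^{(n)}(x)\bigr)=\sum_{i=1}^{x}\left[P_{n-1}(x+1-i)\sum_{k=1}^{\infty}\left\lfloor \frac{i}{p^{k}}\right\rfloor\right]. \]
   Context: $\nu_p(m)$ denotes the $p$-adic valuation (exponent of $p$ in the factorization) of a positive integer $m$. For integers $r\ge 0$ and $m\ge 1$, $P_r(m)=\binom{m+r-1}{r}$ is the $r$-simplex (figurate) number (so $P_0(m)=1$). The generalized superfactorial is defined for positive integers $x$ by $sf^{(0)}(x)=x!$ and $sf^{(n)}(x)=\prod_{k=1}^{x}sf^{(n-1)}(k)$ for $n\ge 1$. *)

(* Defs.v *)
From mathcomp Require Import all_boot.

Set Implicit Arguments.
Unset Strict Implicit.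
Unset Printing Implicit Defensive.

(* Only meaningful for m >= 1, where the truncated subtraction is exact. *)
Definition simplex_number (r m : nat) : nat := 'C(m + r - 1, r).

Fixpoint superfactorial (n x : nat) : nat :=
  if n is n'.+1 then \prod_(1 <= k < x.+1) superfactorial n' k else x`!.

(* Main.v *)
(* Taking valuations turns the iterated products defining sf^(n) into iterated
   partial sums of L(i) = nu_p(i!). Forming partial sums raises the order of the
   simplex numbers by one (the hockey-stick identity), and Legendre's formula
   expands L(i) as a series whose terms vanish for k > i. *)
Require Import Defs.
From mathcomp Require Import all_boot all_order all_algebra.
From mathcomp Require Import all_classical all_reals all_analysis.

Import Order.TTheory GRing.Theory Num.Theory.

Lemma simplex_numberS r m : simplex_number r m.+1 = 'C(m + r, r).
Proof. by rewrite /simplex_number addSn subn1. Qed.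

Lemma simplex_number_pascal r m :
  simplex_number r.+1 m.+2 = simplex_number r.+1 m.+1 + simplex_number r m.+2.
Proof. by rewrite !simplex_numberS addSn binS addSnnS. Qed.

Lemma logn_prod (I : Type) p (s : seq I) (F : I -> nat) :
    (forall i, 0 < F i) ->
  logn p (\prod_(i <- s) F i) = \sum_(i <- s) logn p (F i).
Proof.
move=> F0; elim: s => [|i s IHs]; first by rewrite !big_nil logn1.
by rewrite !big_cons lognM ?prodn_gt0 ?IHs.
Qed.

Lemma superfactorial_gt0 n x : 0 < superfactorial n x.
Proof.
by elim: n x => [|n IHn] x; [exact: fact_gt0|exact: prodn_gt0].
Qed.

(** By induction on [x]: the new outer term [k = x.+1] adds [simplex_number r (x.+2 - i)] to the
    coefficient of each [L i], which is Pascal's rule. *)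
Lemma sum_simplex_convolution r x (L : nat -> nat) :
  \sum_(1 <= k < x.+1) \sum_(1 <= i < k.+1) simplex_number r (k + 1 - i) * L i =
  \sum_(1 <= i < x.+1) simplex_number r.+1 (x + 1 - i) * L i.
Proof.
elim: x => [|x IHx]; first by rewrite !big_geq.
rewrite big_nat_recr//= IHx !(big_nat_recr x.+1)//= addnA -big_split/=.
(* The top index [i = x.+1] is new; its coefficient is 1 on both sides. *)
rewrite [x.+1 + 1]addn1 subSnn !simplex_numberS !add0n !binn.
congr addn; apply: eq_big_nat => i /andP[_ lt_ix].
have le_ix : i <= x by [].
by rewrite addn1 -mulnDl !subSn ?(leqW le_ix)// simplex_number_pascal.
Qed.

(** Induction starts at sf^(1), where the weights are P_0 = 1; each further product is one more
    partial sum. *)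
Lemma logn_superfactorialS p n x :
  logn p (superfactorial n.+1 x) =
  \sum_(1 <= i < x.+1) simplex_number n (x + 1 - i) * logn p i`!.
Proof.
elim: n x => [|n IHn] x.
  rewrite logn_prod; last exact: fact_gt0.
  by apply: eq_bigr => i _; rewrite /simplex_number bin0 mul1n.
rewrite logn_prod; last exact: (superfactorial_gt0 n.+1).
by under eq_bigr do rewrite IHn; rewrite sum_simplex_convolution.
Qed.

Local Open Scope ring_scope.
Local Open Scope ereal_scope.

(** In [\bar R] the nonnegative series has a value without a convergence proof. Cutting it after
    [k = i] leaves exactly the finite sum of [logn_fact]. *)
Lemma legendre_eseries (R : realType) p i : prime p ->
  \sum_(1 <= k <oo) (i %/ p ^ k)%:R%:E = (logn p i`!)%:R%:E :> \bar R.
Proof.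
move=> pr_p; rewrite (nneseries_split 1 i); last first.
  by move=> k _; rewrite lee_fin ler0n.
rewrite eseries0 => [|k lt_ik _].
  by rewrite adde0 add1n sumEFin -natr_sum logn_fact.
(* Tail terms are 0 because [i < k < p ^ k], as [p] is at least 2. *)
rewrite divn_small// (leq_ltn_trans (ltnW lt_ik))//.
exact/ltn_expl/prime_gt1.
Qed.

Theorem theorem8p1 (R : realType) (p x n : nat)
    (hp : prime p) (hx : (0 < x)%N) (hn : (0 < n)%N) :
  (logn p (superfactorial n x))%:R%:E =
    \sum_(1 <= i < x.+1)
      ((simplex_number (n - 1) (x + 1 - i))%:R%:E *
       \sum_(1 <= k <oo) (i %/ p ^ k)%:R%:E) :> \bar R.
Proof.
case: n hn => // n _; rewrite subSS subn0 logn_superfactorialS natr_sum -sumEFin.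
by apply: eq_bigr => i _; rewrite legendre_eseries// natrM EFinM.
Qed.
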